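(* For $n\ge1$ and $k\ge0$, there is a one-to-one correspondence between the $n$-restricted set-partitions of $[n+k]$ and the basis vectors $$(v_{i_1}\otimes v_{i_2}\otimes\cdots\otimes v_{i_k},\mathcal{D})$$ of $W_{k,n}$, where $\mathcal{D}=\{C_1,\dots,C_l\}$ is a set-partition of a subset of $[k]$, $v_{i_j}=e_0$ if and only if $j\in C_1\cup\cdots\cup C_l$, and $v_{i_j}\in\{e_1,\dots,e_n\}$ if $j\notin C_1\cup\cdots\cup C_l$.
   Context: $[m]=\{1,\dots,m\}$. A set-partition of a set $A\supseteq[n]$ is called $n$-restricted if the elements of $[n]$ lie in pairwise distinct parts. The number of $n$-restricted set-partitions of $[n+k]$ is called the generalized Bell number. $W_{k,n}$ is the module $(\operatorname{Ind}^{R_n}_{R_{n-1}}\circ\operatorname{Res}^{R_n}_{R_{n-1}})^k(\mathbb{C}_{\mathrm{triv}})$ of the rook monoid $R_n$ ($n\times n$ matrices over $\{0,1\}$ with at most one $1$ in each row and column), which the paper describes through the basis in the claim; $e_1,\dots,e_n$ is the standard basis of $\mathbb{C}^n$ and $e_0$ is a basis vector of the trivial module $\mathbb{C}_{\mathrm{triv}}$. The empty set has exactly one set-partition, the empty one. *)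

(* Defs.v *)
From HB Require Import structures.
From mathcomp Require Import all_boot all_order all_algebra.
From mathcomp Require Import reals complex.

Set Implicit Arguments.
Unset Strict Implicit.
Unset Printing Implicit Defensive.

Import GRing.Theory.
Local Open Scope ring_scope.

(* Indices are 0-based: [n+k] is 'I_(n + k), its subset [n] is the image of
   lshift k : 'I_n -> 'I_(n + k), and [k] is 'I_k. *)

Definition restricted_partition (n k : nat) (P : {set {set 'I_(n + k)}}) : Prop :=
  partition P [set: 'I_(n + k)] /\
  forall i j : 'I_n, i != j -> pblock P (lshift k i) != pblock P (lshift k j).

Definition subset_partition (k : nat) (D : {set {set 'I_k}}) : Prop :=
  exists A : {set 'I_k}, partition D A.

Section TensorModule.
Variables (R : realType) (n k : nat).

(* C_triv (+) C^n, the first coordinate being the one of C_triv. *)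
Definition U := 'rV[R[i]]_(1 + n).

Definition e0 : U := row_mx 1%:M 0.
Definition e (i : 'I_n) : U := row_mx 0 (delta_mx 0 i).

(* The k-th tensor power of U, in coordinates: t s is the coefficient of the
   tensor of the standard basis vectors of indices s 0, ..., s (k - 1). *)
Definition tensor_power := {ffun {ffun 'I_k -> 'I_(1 + n)} -> R[i]^o}.

Definition tensor (v : 'I_k -> U) : tensor_power :=
  [ffun s : {ffun 'I_k -> 'I_(1 + n)} => \prod_(j < k) v j 0 (s j)].

(* A direct sum of copies of the tensor power, indexed by D; (t, D) is the
   tensor t placed in the copy of index D. *)
Definition ambient := {ffun {set {set 'I_k}} -> tensor_power}.

Definition in_copy (t : tensor_power) (D : {set {set 'I_k}}) : ambient :=
  [ffun D' => if D' == D then t else 0].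

Definition basis_vector (w : ambient) : Prop :=
  exists (v : 'I_k -> U) (D : {set {set 'I_k}}),
    [/\ subset_partition D,
        forall j : 'I_k, v j = e0 <-> j \in cover D,
        forall j : 'I_k, j \notin cover D -> exists i : 'I_n, v j = e i
      & w = in_copy (tensor v) D].

(* W_{k,n} is the span of the basis vectors. Since C is not a finite type, the
   span is taken over labels: a label (s, D) stands for the vector whose j-th
   tensor factor is e_0 if s j = None and e_i if s j = Some i. *)
Definition label := ({ffun 'I_k -> option 'I_n} * {set {set 'I_k}})%type.

Definition label_vector (l : label) : ambient :=
  in_copy (tensor (fun j => oapp e e0 (l.1 j))) l.2.

Definition label_ok : pred label := fun l =>
  partition l.2 (cover l.2) &&
  [forall j : 'I_k, (l.1 j == None) == (j \in cover l.2)].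

Definition W_basis : seq ambient := [seq label_vector l | l <- enum label_ok].

Definition W : {vspace ambient} := <<W_basis>>%VS.

Lemma oappE (o : option 'I_n) :
  oapp e e0 o = delta_mx 0 (oapp (fun i => rshift 1 i) (lshift n 0) o).
Proof.
apply/rowP=> c; rewrite -(splitK c); case: (split c) => a /=.
- case: o => [i|] /=.
    by rewrite /e row_mxEl !mxE eq_lrshift.
  by rewrite /e0 row_mxEl !mxE eq_lshift !ord1.
- case: o => [i|] /=.
    by rewrite /e row_mxEr !mxE eq_rshift.
  by rewrite /e0 row_mxEr !mxE eq_rlshift.
Qed.

Lemma e_neq_e0 (i : 'I_n) : e i <> e0.
Proof.
move/rowP/(_ (lshift n 0)); rewrite /e /e0 !row_mxEl !mxE eqxx /=.
by move/eqP; rewrite eq_sym oner_eq0.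
Qed.

Definition label_index (l : label) : {ffun 'I_k -> 'I_(1 + n)} :=
  [ffun j => oapp (fun i => rshift 1 i) (lshift n 0) (l.1 j)].

Lemma label_vectorE (l : label) D s :
  label_vector l D s = ((D == l.2) && (s == label_index l))%:R.
Proof.
rewrite /label_vector /in_copy ffunE; case: (D == l.2) => /=; last by rewrite ffunE.
rewrite ffunE; case: eqP => [->|ne].
  by rewrite big1 // => j _; rewrite oappE !mxE ffunE !eqxx.
have [j nej] : exists j, s j != label_index l j.
  apply/existsP; rewrite -negb_forall; apply/negP => /forallP h.
  by apply: ne; apply/ffunP => j; apply/eqP.
by rewrite (bigD1 j) //= oappE !mxE eqxx /= ffunE in nej *; rewrite (negbTE nej) mul0r.
Qed.

Lemma label_index_inj (l l' : label) :
  l.2 = l'.2 -> label_index l = label_index l' -> l = l'.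
Proof.
case: l l' => [s D] [s' D'] /= -> /ffunP h; congr (_, _).
apply/ffunP=> j; move: (h j); rewrite !ffunE /=.
by case: (s j) (s' j) => [a|] [b|] //= /eqP; rewrite ?eq_rshift ?eq_rlshift ?eq_lrshift // => /eqP->.
Qed.

Lemma basis_vectorP (w : ambient) : basis_vector w <-> w \in W_basis.
Proof.
split=> [[v [D [[A PA] h0 h1 ->]]]|/mapP[l]].
- pose s : {ffun 'I_k -> option 'I_n} :=
    [ffun j => if j \in cover D then None else [pick i | v j == e i]].
  have vs j : v j = oapp e e0 (s j).
    rewrite ffunE; case: ifPn => [/h0 //|/h1 [i vi]].
    by case: pickP => [i' /eqP //|/(_ i)]; rewrite vi eqxx.
  apply/mapP; exists (s, D).
    rewrite mem_enum unfold_in /= (cover_partition PA) PA /=; apply/forallP => j.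
    rewrite -(cover_partition PA); apply/eqP; apply/idP/idP.
      by move/eqP=> sj; apply/h0; rewrite vs sj.
    by move=> jD; rewrite ffunE jD.
  rewrite /label_vector /=; congr in_copy; apply/ffunP => t; rewrite !ffunE.
  by apply: eq_bigr => j _; rewrite vs.
- rewrite mem_enum => /andP[PD /forallP hs] ->.
  exists (fun j => oapp e e0 (l.1 j)), l.2; split => //.
  + by exists (cover l.2).
  + move=> j; rewrite -(eqP (hs j)); case: (l.1 j) => [i|] //=.
    by split=> // /e_neq_e0.
  + by move=> j; rewrite -(eqP (hs j)); case: (l.1 j) => [i|] //= _; exists i.
Qed.

Lemma W_basis_uniq : uniq W_basis.
Proof.
rewrite map_inj_uniq ?enum_uniq // => l l' /ffunP/(_ l.2)/ffunP/(_ (label_index l)).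
rewrite !label_vectorE !eqxx /=; case: andP => [[/eqP h2 /eqP h1] _|_ /eqP].
  exact: label_index_inj.
by rewrite oner_eq0.
Qed.

Lemma W_basisP : basis_of W W_basis.
Proof.
rewrite /basis_of eqxx /=; apply/(@freeP _ _ _ (in_tuple W_basis)) => c /= sum0 a.
have szE : size W_basis = size (enum label_ok) by rewrite size_map.
have [l0 _] : exists l : label, true by exists ([ffun=> None], set0).
pose lab (b : 'I_(size W_basis)) := nth l0 (enum label_ok) b.
have labE (b : 'I_(size W_basis)) : W_basis`_b = label_vector (lab b).
  by rewrite (nth_map l0) // -szE.
move: sum0 => /ffunP/(_ (lab a).2)/ffunP/(_ (label_index (lab a))).
rewrite 2!sum_ffunE !ffunE (bigD1 a) //= big1 ?addr0.
  by rewrite !ffunE labE label_vectorE !eqxx /= => <-; rewrite /GRing.scale /= mulr1.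
move=> b ba; rewrite !ffunE labE label_vectorE.
case: andP => [[/eqP h2 /eqP h1]|_]; last by rewrite /= scaler0.
have /eqP := label_index_inj h2 h1.
by rewrite nth_uniq -?szE ?enum_uniq // => /eqP/val_inj ab; rewrite ab eqxx in ba.
Qed.

End TensorModule.

(* Main.v *)
Require Import Defs.
From mathcomp Require Import classical_sets functions reals complex.
From mathcomp Require Import all_boot all_algebra.

(** A basis vector amounts to a label [(s, D)]: [s j = Some i] says that the
    [j]-th tensor factor is [e i], and [s j = None] that it is [e0], which
    happens exactly when [j] is covered by the partition [D].

    In an [n]-restricted partition [P] of [[n+k]] every part contains at most
    one element of [[n]].  A part containing [i] of [[n]] is determined by [i]
    together with the elements of [[k]] that it has besides [i]; a part without
    any element of [[n]] is a nonempty subset of [[k]].  So give [e i] as a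
    factor to those [j] in [[k]] that lie in the part of [i], give [e0] to the
    others, and let [D] be the set of parts that avoid [[n]], viewed in [[k]].

    To see that this is bijective, name each part by an element of
    [[n] + {subsets of [k]}]: the [i] that it contains if there is one, and
    otherwise itself.  In a restricted partition distinct parts have distinct
    names ([block_name_inj]), so [P] is the partition into the fibres of the
    map sending a point to the name of its part.  That map can be read off from
    the label alone ([point_name]).  This gives the inverse: a label is sent to
    the partition into fibres of its naming map.  The two composites are the
    identity by [label_ofK] and [partition_ofK], each of which rests on the
    fact that the two ways of naming a point agree. *)

Definition block_name {n k : nat} (B : {set 'I_(n + k)}) : 'I_n + {set 'I_k} :=
  if [pick i | lshift k i \in B] is Some i then inl i
  else inr [set j | rshift n j \in B].

Definition name_index {n k : nat} (u : 'I_n + {set 'I_k}) : option 'I_n :=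
  if u is inl i then Some i else None.

Definition label_of {n k : nat} (P : {set {set 'I_(n + k)}}) : label n k :=
  ([ffun j => name_index (block_name (pblock P (rshift n j)))],
   [set C | inr C \in [set block_name B | B in P]]).

(** The name that the part of [x] ought to have, according to the label. *)
Definition point_name {n k : nat} (l : label n k) (x : 'I_(n + k)) :
    'I_n + {set 'I_k} :=
  match split x with
  | inl i => inl i
  | inr j => if l.1 j is Some i then inl i else inr (pblock l.2 j)
  end.

Definition partition_of {n k : nat} (l : label n k) : {set {set 'I_(n + k)}} :=
  preim_partition (point_name l) [set: 'I_(n + k)].

Lemma point_name_lshift {n k : nat} (l : label n k) (i : 'I_n) :
  point_name l (lshift k i) = inl i.
Proof. by rewrite /point_name -[lshift k i]/(unsplit (inl i)) unsplitK. Qed.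

Lemma point_name_rshift {n k : nat} (l : label n k) (j : 'I_k) :
  point_name l (rshift n j) =
  if l.1 j is Some i then inl i else inr (pblock l.2 j).
Proof. by rewrite /point_name -[rshift n j]/(unsplit (inr j)) unsplitK. Qed.

Lemma block_name_inr {n k : nat} {B : {set 'I_(n + k)}} {C : {set 'I_k}} :
  block_name B = inr C ->
  (forall i, lshift k i \notin B) /\ C = [set j | rshift n j \in B].
Proof.
rewrite /block_name; case: pickP => // h [<-]; split => // i.
by rewrite h.
Qed.

Lemma block_name_inl {n k : nat} {B : {set 'I_(n + k)}} {i : 'I_n} :
  block_name B = inl i -> lshift k i \in B.
Proof. by rewrite /block_name; case: pickP => // a ? [<-]. Qed.

Lemma restricted_pblock {n k : nat} {P : {set {set 'I_(n + k)}}}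
    {B : {set 'I_(n + k)}} {x : 'I_(n + k)} :
  restricted_partition P -> B \in P -> x \in B -> pblock P x = B.
Proof. by case=> /partition_trivIset tP _; apply: def_pblock. Qed.

Lemma restricted_in_pblock {n k : nat} {P : {set {set 'I_(n + k)}}}
    (x : 'I_(n + k)) :
  restricted_partition P -> (pblock P x \in P) * (x \in pblock P x).
Proof.
by case=> PT _; rewrite mem_pblock pblock_mem (cover_partition PT) inE.
Qed.

Lemma block_name_lshift {n k : nat} {P : {set {set 'I_(n + k)}}}
    {B : {set 'I_(n + k)}} {i : 'I_n} :
  restricted_partition P -> B \in P -> lshift k i \in B -> block_name B = inl i.
Proof.
move=> rP BP iB; rewrite /block_name; case: pickP => [a aB|/(_ i)]; last first.
  by rewrite iB.
congr inl; apply/eqP; apply: contraT => /(proj2 rP).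
by rewrite (restricted_pblock rP BP iB) (restricted_pblock rP BP aB) eqxx.
Qed.

(** A part containing [i] is the part of [i], and a part without any element of
    [[n]] is its own name; so a name determines the part. *)
Lemma block_name_inj {n k : nat} {P : {set {set 'I_(n + k)}}} :
  restricted_partition P -> {in P &, injective block_name}.
Proof.
move=> rP A B AP BP; case nB: (block_name B) => [i|C] nA.
  have iA := block_name_inl nA; have iB := block_name_inl nB.
  by rewrite -(restricted_pblock rP AP iA) (restricted_pblock rP BP iB).
have [B0 defC] := block_name_inr nB.
have [A0] := block_name_inr nA; rewrite defC => /setP eqBA.
apply/setP => x; rewrite -(splitK x); case: (split x) => a /=.
  by rewrite (negbTE (A0 a)) (negbTE (B0 a)).
by have := eqBA a; rewrite !inE.
Qed.

Lemma mem_label_of {n k : nat} {P : {set {set 'I_(n + k)}}} {C : {set 'I_k}} :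
  reflect (exists2 B, B \in P & block_name B = inr C) (C \in (label_of P).2).
Proof.
by rewrite inE; apply: (iffP imsetP) => -[B BP nB]; exists B.
Qed.

(** A class of the second component of the label is the trace on [[k]] of a part
    of [P], hence of the part of any of its points. *)
Lemma label_of_class {n k : nat} {P : {set {set 'I_(n + k)}}} {C : {set 'I_k}}
    {j : 'I_k} :
  restricted_partition P -> C \in (label_of P).2 -> j \in C ->
  block_name (pblock P (rshift n j)) = inr C.
Proof.
move=> rP /mem_label_of[B BP nB]; have [_ ->] := block_name_inr nB.
by rewrite inE => jB; rewrite (restricted_pblock rP BP jB) nB -(block_name_inr nB).2.
Qed.

Lemma label_of_trivIset {n k : nat} {P : {set {set 'I_(n + k)}}} :
  restricted_partition P -> trivIset (label_of P).2.
Proof.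
move=> rP; apply/trivIsetP => C1 C2 C1D C2D; apply: contraR.
case/pred0Pn => j /andP[/= jC1 jC2].
have := label_of_class rP C1D jC1.
by rewrite (label_of_class rP C2D jC2) => -[->].
Qed.

Lemma label_of_ok {n k : nat} {P : {set {set 'I_(n + k)}}} :
  restricted_partition P -> label_ok (label_of P).
Proof.
move=> rP; rewrite /label_ok /partition eqxx label_of_trivIset //=.
apply/andP; split.
  apply/negP => /mem_label_of[B BP nB]; have [B0 /setP tB] := block_name_inr nB.
  have /set0Pn[x] : B != set0.
    by apply: contraTneq BP => ->; rewrite (partition0 (proj1 rP)).
  rewrite -(splitK x); case: (split x) => a /= xB.
    by move: (B0 a); rewrite xB.
  by have := tB a; rewrite !inE xB.
apply/forallP => j; rewrite ffunE; apply/eqP; apply/idP/bigcupP; last first.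
  by case=> C CD jC; rewrite (label_of_class rP CD jC).
have [bP jb] := restricted_in_pblock (rshift n j) rP.
case nB: (block_name _) => [i|C] // _; exists C.
  by apply/mem_label_of; exists (pblock P (rshift n j)).
by have [_ ->] := block_name_inr nB; rewrite inE.
Qed.

Lemma point_name_label_of {n k : nat} {P : {set {set 'I_(n + k)}}}
    (x : 'I_(n + k)) :
  restricted_partition P ->
  point_name (label_of P) x = block_name (pblock P x).
Proof.
move=> rP; rewrite -(splitK x); case: (split x) => a /=.
  have [bP ab] := restricted_in_pblock (lshift k a) rP.
  by rewrite point_name_lshift (block_name_lshift rP bP ab).
rewrite point_name_rshift ffunE.
have [bP ab] := restricted_in_pblock (rshift n a) rP.
case nB: (block_name _) => [i|C] //=; congr inr.
apply: def_pblock (label_of_trivIset rP) _ _.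
  by apply/mem_label_of; exists (pblock P (rshift n a)).
by have [_ ->] := block_name_inr nB; rewrite inE.
Qed.

(** Since parts are determined by their names, having the same name is the same
    relation on points as lying in the same part. *)
Lemma label_ofK {n k : nat} {P : {set {set 'I_(n + k)}}} :
  restricted_partition P -> partition_of (label_of P) = P.
Proof.
move=> rP; rewrite -[RHS](preim_partition_pblock (proj1 rP)).
apply: eq_imset => x; apply/setP => y; rewrite !inE /=.
rewrite !point_name_label_of // (inj_in_eq (block_name_inj rP)) //.
  exact: (restricted_in_pblock _ rP).1.
exact: (restricted_in_pblock _ rP).1.
Qed.

Lemma mem_pblock_partition_of {n k : nat} (l : label n k) (x y : 'I_(n + k)) :
  (y \in pblock (partition_of l) x) = (point_name l x == point_name l y).
Proof.
rewrite pblock_equivalence_partition ?inE // => a b c _ _ _.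
by split=> // /eqP->.
Qed.

Lemma partition_of_restricted {n k : nat} (l : label n k) :
  restricted_partition (partition_of l).
Proof.
have PT : partition (partition_of l) [set: 'I_(n + k)] := preim_partitionP _ _.
split=> // i j; apply: contra.
rewrite eq_pblock ?(partition_trivIset PT) ?(cover_partition PT) ?inE //.
by rewrite mem_pblock_partition_of !point_name_lshift.
Qed.

(** The fibre over [inl i] contains [i], which names it.  For a fibre over
    [inr C], the condition on labels is used: [D] is a partition of exactly the
    points labelled [None], so the points with name [inr C] are the elements of
    [C], and the fibre is its own name. *)
Lemma block_name_partition_of {n k : nat} (l : label n k) (x : 'I_(n + k)) :
  label_ok l -> block_name (pblock (partition_of l) x) = point_name l x.
Proof.
case/andP=> PD /forallP s0; rewrite /block_name; case: pickP => [i|no].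
  by rewrite mem_pblock_partition_of point_name_lshift => /eqP.
case nx: (point_name l x) => [i|C].
  by have := no i; rewrite mem_pblock_partition_of point_name_lshift nx eqxx.
congr inr; move: nx no; rewrite -(splitK x); case: (split x) => a /=.
  by rewrite point_name_lshift.
move=> nx _; have := nx; rewrite point_name_rshift.
case sa: (l.1 a) => [//|] [Ca].
have aD : a \in cover l.2 by rewrite -(eqP (s0 a)) sa.
apply/setP => j; rewrite inE mem_pblock_partition_of nx -Ca point_name_rshift.
case sj: (l.1 j) => [i|]; last exact: (eq_pblock j (partition_trivIset PD) aD).
apply/esym/negP => ja; have : j \in cover l.2.
  by apply/bigcupP; exists (pblock l.2 a) => //; apply: pblock_mem.
by rewrite -(eqP (s0 j)) sj.
Qed.

Lemma partition_ofK {n k : nat} (l : label n k) :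
  label_ok l -> label_of (partition_of l) = l.
Proof.
move=> okl; have /andP[PD /forallP s0] := okl.
have rP := partition_of_restricted l.
rewrite [RHS]surjective_pairing; congr pair.
  apply/ffunP => j; rewrite ffunE block_name_partition_of // point_name_rshift.
  by case: (l.1 j).
apply/setP => C; apply/mem_label_of/idP => [[B BP nB]|CD].
  have /set0Pn[x xB] : B != set0.
    by apply: contraTneq BP => ->; rewrite (partition0 (proj1 rP)).
  move: nB; rewrite -(restricted_pblock rP BP xB) block_name_partition_of //.
  rewrite -(splitK x); case: (split x) => j /=.
    by rewrite point_name_lshift.
  rewrite point_name_rshift; case sj: (l.1 j) => [//|] [<-].
  by apply: pblock_mem; rewrite -(eqP (s0 j)) sj.
have /set0Pn[j jC] : C != set0.
  by apply: contraTneq CD => ->; rewrite (partition0 PD).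
exists (pblock (partition_of l) (rshift n j)).
  exact: (restricted_in_pblock _ rP).1.
have /eqP sj : l.1 j == None by rewrite (eqP (s0 j)); apply/bigcupP; exists C.
rewrite block_name_partition_of // point_name_rshift sj.
by rewrite (def_pblock (partition_trivIset PD) CD jC).
Qed.

Lemma label_vector_inj (R : realType) {n k : nat} :
  injective (@label_vector R n k).
Proof.
move=> l l' /ffunP/(_ l.2)/ffunP/(_ (label_index l)).
rewrite !label_vectorE !eqxx /=; case: andP => [[/eqP h2 /eqP h1] _|_ /eqP].
  exact: label_index_inj.
by rewrite GRing.oner_eq0.
Qed.

Theorem proposition4p2 (R : realType) (n k : nat) (hn : (0 < n)%N) :
  exists f : {set {set 'I_(n + k)}} -> ambient R n k,
    set_bij (@restricted_partition n k) (@basis_vector R n k) f.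
Proof.
exists (fun P => label_vector R (label_of P)); split.
- move=> P rP; apply/basis_vectorP/mapP; exists (label_of P) => //.
  by rewrite mem_enum; apply: label_of_ok.
- move=> P Q /set_mem rP /set_mem rQ /label_vector_inj eqPQ.
  by rewrite -(label_ofK rP) eqPQ label_ofK.
- move=> w /basis_vectorP/mapP[l]; rewrite mem_enum => okl ->.
  exists (partition_of l); first exact: partition_of_restricted.
  by rewrite partition_ofK.
Qed.
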